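(* Let $H, W$ be positive integers and $N = H \times W$. Let $\alpha_{i,j}, \beta_{i,j} \in [0,1]$ ($1 \le i \le H$, $1 \le j \le W$) be decay factors, let $L \in \mathbb{R}^{N \times N}$ be the associated polyline path mask, and let $x \in \mathbb{R}^{N}$. The computational complexity of the matrix multiplication between the polyline path mask and the vector $x$, i.e. of computing $y = Lx$, can be reduced from $\mathcal{O}(N^2)$ to $\mathcal{O}(N^{3/2})$ by the following algorithm, with input $(\alpha, \beta, x)$ and output $y$: 1. compute $X = \mathrm{unvec}(x) \in \mathbb{R}^{H \times W}$; 2. compute $B^l \in \mathbb{R}^{H \times H}$, where for $l = 1, \dots, W$, $[B^l]_{i,k} = \beta_{i:k,l}$; 3. compute $Z \in \mathbb{R}^{H \times W}$, where $Z_{:,l} = B^l \times X_{:,l}$; 4. compute $A^i \in \mathbb{R}^{W \times W}$, where for $i = 1, \dots, H$, $[A^i]_{j,l} = \alpha_{i,j:l}$; 5. compute $Y \in \mathbb{R}^{H \times W}$, where $Y_{i,:} = A^i \times Z_{i,:}$; output $y = \mathrm{vec}(Y)$. The complexity can be further reduced to $\mathcal{O}(N)$ by applying the chunkwise algorithm of Mamba2 (for multiplication by 1-semiseparable matrices) to steps 3 and 5 of this algorithm.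
   Context: Given decay factors $\alpha_{i,j}, \beta_{i,j} \in [0,1]$ on the $H \times W$ grid, set $$\alpha_{i,j:l} = \begin{cases} \prod_{n=j+1}^{l} \alpha_{i,n} & j < l \\ 1 & j = l \\ \prod_{n=l+1}^{j} \alpha_{i,n} & j > l \end{cases}, \qquad \beta_{i:k,l} = \begin{cases} \prod_{n=i+1}^{k} \beta_{n,l} & i < k \\ 1 & i = k \\ \prod_{n=k+1}^{i} \beta_{n,l} & i > k \end{cases}.$$ The polyline path mask is the matrix $L \in \mathbb{R}^{HW \times HW}$ with entries $L_{(i-1)W+j,\ (k-1)W+l} = \alpha_{i,j:l}\, \beta_{i:k,l}$ for $1 \le i,k \le H$, $1 \le j,l \le W$. For $x \in \mathbb{R}^{HW}$, $\mathrm{unvec}(x) \in \mathbb{R}^{H \times W}$ has entries $[\mathrm{unvec}(x)]_{i,j} = x_{(i-1)W+j}$, and $\mathrm{vec}$ is the inverse of $\mathrm{unvec}$. Columns $X_{:,l}$ and rows $Z_{i,:}$, $Y_{i,:}$ are regarded as column vectors. A 1-semiseparable matrix generated by scalars $a_1, \dots, a_n$ is the lower triangular matrix $T \in \mathbb{R}^{n \times n}$ with $T_{ij} = a_{i} a_{i-1} \cdots a_{j+1}$ for $i > j$, $T_{ii} = 1$, and $T_{ij} = 0$ for $i < j$. The chunkwise algorithm of Mamba2 reduces the complexity of multiplying an $n \times n$ 1-semiseparable matrix by a vector from $\mathcal{O}(n^2)$ to $\mathcal{O}(n)$. The matrices $A^i$ and $B^l$ are symmetric, with lower triangular parts that are 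1-semiseparable.
   Formalization: The O(N^{3/2}) bound is stated for H ≤ κW and W ≤ κH, with constant depending on κ (any κ), and as O(N(H+W)) for all H, W, since for H = 1 steps 4 and 5 already cost order N^2. *)

(* Defs.v *)
(* Indices are 0-based: the 1-based i <= H, j <= W become
   i : 'I_H, j : 'I_W, and position (i-1)W+j of a vector becomes i * W + j. *)
From HB Require Import structures.
From mathcomp Require Import all_boot all_order all_algebra.

Set Implicit Arguments.
Unset Strict Implicit.
Unset Printing Implicit Defensive.

Import Order.TTheory GRing.Theory Num.Theory.

Lemma grid_idx_subproof (H W : nat) (i : 'I_H) (j : 'I_W) : i * W + j < H * W.
Proof.
apply: (@leq_trans (i.+1 * W)); first by rewrite mulSn addnC ltn_add2r.
by rewrite leq_mul2r ltn_ord orbT.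
Qed.

Lemma grid_row_subproof (H W : nat) (p : 'I_(H * W)) : p %/ W < H.
Proof.
case: p => p /=; case: W => [|W]; first by rewrite muln0.
by rewrite ltn_divLR.
Qed.

Lemma grid_col_subproof (H W : nat) (p : 'I_(H * W)) : p %% W < W.
Proof.
case: p => p /=; case: W => [|W]; first by rewrite muln0.
by rewrite ltn_mod.
Qed.

Definition grid_idx (H W : nat) (i : 'I_H) (j : 'I_W) : 'I_(H * W) :=
  Ordinal (grid_idx_subproof i j).
Definition grid_row (H W : nat) (p : 'I_(H * W)) : 'I_H :=
  Ordinal (grid_row_subproof p).
Definition grid_col (H W : nat) (p : 'I_(H * W)) : 'I_W :=
  Ordinal (grid_col_subproof p).

Lemma grid_idxK (H W : nat) (p : 'I_(H * W)) :
  grid_idx (grid_row p) (grid_col p) = p.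
Proof. by apply: val_inj; rewrite /= -divn_eq. Qed.

Lemma grid_rowK (H W : nat) (i : 'I_H) (j : 'I_W) : grid_row (grid_idx i j) = i.
Proof.
apply: val_inj => /=; have W_gt0 : 0 < W by apply: leq_ltn_trans (ltn_ord j).
by rewrite divnMDl // divn_small // addn0.
Qed.

Lemma grid_colK (H W : nat) (i : 'I_H) (j : 'I_W) : grid_col (grid_idx i j) = j.
Proof. by apply: val_inj; rewrite /= modnMDl modn_small. Qed.

Local Open Scope ring_scope.

Definition unvec (T : Type) (H W : nat) (x : 'cV[T]_(H * W)) : 'M[T]_(H, W) :=
  \matrix_(i, j) x (grid_idx i j) ord0.

Definition vec (T : Type) (H W : nat) (X : 'M[T]_(H, W)) : 'cV[T]_(H * W) :=
  \col_p X (grid_row p) (grid_col p).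

Lemma vecK (T : Type) (H W : nat) : cancel (@vec T H W) (@unvec T H W).
Proof. by move=> X; apply/matrixP => i j; rewrite !mxE grid_rowK grid_colK. Qed.

Lemma unvecK (T : Type) (H W : nat) : cancel (@unvec T H W) (@vec T H W).
Proof.
by move=> x; apply/matrixP => p k; rewrite !mxE grid_idxK (ord1 k).
Qed.

Definition decay_factors (R : numDomainType) (H W : nat) (a : 'M[R]_(H, W)) :=
  forall i j, 0 <= a i j <= 1.

Definition segprod (R : comNzRingType) (n : nat) (a : 'I_n -> R) (i k : 'I_n) : R :=
  if (i < k)%N then \prod_(t < n | (i < t <= k)%N) a t
  else if (k < i)%N then \prod_(t < n | (k < t <= i)%N) a t
  else 1.

(* alpha_{i,j:l} and beta_{i:k,l}. *)
Definition alpha_seg (R : comNzRingType) (H W : nat) (alpha : 'M[R]_(H, W))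
  (i : 'I_H) (j l : 'I_W) : R := segprod (fun t => alpha i t) j l.
Definition beta_seg (R : comNzRingType) (H W : nat) (beta : 'M[R]_(H, W))
  (i k : 'I_H) (l : 'I_W) : R := segprod (fun t => beta t l) i k.

Definition polyline_mask (R : comNzRingType) (H W : nat)
    (alpha beta : 'M[R]_(H, W)) : 'M[R]_(H * W) :=
  \matrix_(p, q) (alpha_seg alpha (grid_row p) (grid_col p) (grid_col q)
                  * beta_seg beta (grid_row p) (grid_row q) (grid_col q)).

Lemma polyline_maskE (R : comNzRingType) (H W : nat) (alpha beta : 'M[R]_(H, W))
    (i k : 'I_H) (j l : 'I_W) :
  polyline_mask alpha beta (grid_idx i j) (grid_idx k l)
  = alpha_seg alpha i j l * beta_seg beta i k l.
Proof. by rewrite mxE !grid_rowK !grid_colK. Qed.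

(* The matrices A^i and B^l. *)
Definition Amx (R : comNzRingType) (H W : nat) (alpha : 'M[R]_(H, W))
  (i : 'I_H) : 'M[R]_W := \matrix_(j, l) alpha_seg alpha i j l.
Definition Bmx (R : comNzRingType) (H W : nat) (beta : 'M[R]_(H, W))
  (l : 'I_W) : 'M[R]_H := \matrix_(i, k) beta_seg beta i k l.

Definition semisep1 (R : comNzRingType) (n : nat) (a : 'cV[R]_n) : 'M[R]_n :=
  \matrix_(i, j) (if (j < i)%N then \prod_(t < n | (j < t <= i)%N) a t ord0
                  else (i == j)%:R).

(* Cost model: unit-cost scalar machine.  An algorithm is a program written for
   an arbitrary type T of scalars, so the only way it can produce a scalar or
   move one into new storage is an instruction, and each executed instruction
   costs 1.  Reading an operand at a computed address (an index into a stored
   array, a row, a reversal) is part of the instruction that uses it.  For is a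
   loop with independent iterations whose results are stored in an array;
   Bind runs a program once and passes on its result. *)
Inductive instr (T : Type) : Type :=
| Zero
| One
| Copy of T
| Add of T & T
| Sub of T & T
| Mul of T & T.
Arguments Zero {T}.
Arguments One {T}.

Inductive prog (T : Type) : Type -> Type :=
| Ret A (a : A) : prog T A
| Do (c : instr T) : prog T T
| Bind A B (p : prog T A) (k : A -> prog T B) : prog T B
| For A n (f : 'I_n -> prog T A) : prog T {ffun 'I_n -> A}.
Arguments Ret {T A} a.

Notation "'let*' x := p 'in' q" := (Bind p (fun x => q))
  (at level 200, x name, p at level 100, q at level 200,
   format "'[hv' 'let*'  x  :=  p  'in'  '/' q ']'").

Definition exec (R : nzRingType) (c : instr R) : R :=
  match c with
  | Zero => 0
  | One => 1
  | Copy x => x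
  | Add x y => x + y
  | Sub x y => x - y
  | Mul x y => x * y
  end.

Fixpoint run (R : nzRingType) (A : Type) (p : prog R A) : A :=
  match p in prog _ A return A with
  | Ret _ a => a
  | Do c => exec c
  | Bind _ _ p k => run (k (run p))
  | For _ _ f => [ffun i => run (f i)]
  end.

Fixpoint cost (R : nzRingType) (A : Type) (p : prog R A) : nat :=
  match p with
  | Ret _ _ => 0%N
  | Do _ => 1%N
  | Bind _ _ p k => (cost p + cost (k (run p)))%N
  | For _ n f => (\sum_(i < n) cost (f i))%N
  end.

Definition For2 (T : Type) (m n : nat) (f : 'I_m -> 'I_n -> prog T T) :
    prog T 'M[T]_(m, n) :=
  let* F := For (fun i => For (fun j => f i j)) in
  Ret (\matrix_(i, j) F i j).

Fixpoint foldM (T A U : Type) (f : A -> U -> prog T A) (a : A) (s : seq U) :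
    prog T A :=
  if s is u :: s' then let* b := f a u in foldM f b s' else Ret a.

Fixpoint scanM (T A U : Type) (f : A -> U -> prog T A) (a : A) (s : seq U) :
    prog T (seq A) :=
  if s is u :: s' then
    let* b := f a u in let* r := scanM f b s' in Ret (b :: r)
  else Ret [::].

Definition dot (T : Type) (n : nat) (u v : 'I_n -> T) : prog T T :=
  let* z := Do Zero in
  foldM (fun acc i => let* t := Do (Mul (u i) (v i)) in Do (Add acc t))
        z (enum 'I_n).

Definition matvec (T : Type) (m n : nat) (M : 'M[T]_(m, n)) (v : 'cV[T]_n) :
    prog T 'cV[T]_m :=
  let* F := For (fun i => dot (fun j => M i j) (fun j => v j ord0)) in
  Ret (\col_i F i).

(* Entry j of the result is 1, a_{j+1}, a_{j+1} a_{j+2}, ..., a_{j+1}...a_{n-1}. *)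
Definition segments (T : Type) (n : nat) (a : 'cV[T]_n) :
    prog T {ffun 'I_n -> seq T} :=
  For (fun j =>
    let* o := Do One in
    let* s := scanM (fun acc t => Do (Mul acc (a t ord0))) o
                    (drop j.+1 (enum 'I_n)) in
    Ret (o :: s)).

(* The symmetric matrix of the segment products of a (A^i or B^l). *)
Definition decay_prog (T : Type) (n : nat) (a : 'cV[T]_n) : prog T 'M[T]_n :=
  let* o := Do One in
  let* P := segments a in
  For2 (fun i k => Do (Copy (if (k <= i)%N then nth o (P k) (i - k)
                             else nth o (P i) (k - i)))).

Definition semisep1_prog (T : Type) (n : nat) (a : 'cV[T]_n) : prog T 'M[T]_n :=
  let* o := Do One in
  let* P := segments a in
  For2 (fun i k => Do (if (k <= i)%N then Copy (nth o (P k) (i - k)) else Zero)).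

Definition unvec_prog (T : Type) (H W : nat) (x : 'cV[T]_(H * W)) :
    prog T 'M[T]_(H, W) :=
  For2 (fun i j => Do (Copy (unvec x i j))).

Definition vec_prog (T : Type) (H W : nat) (X : 'M[T]_(H, W)) :
    prog T 'cV[T]_(H * W) :=
  let* F := For (fun p => Do (Copy (vec X p ord0))) in Ret (\col_p F p).

Definition B_prog (T : Type) (H W : nat) (beta : 'M[T]_(H, W)) :
    prog T {ffun 'I_W -> 'M[T]_H} :=
  For (fun l => decay_prog (col l beta)).

Definition A_prog (T : Type) (H W : nat) (alpha : 'M[T]_(H, W)) :
    prog T {ffun 'I_H -> 'M[T]_W} :=
  For (fun i => decay_prog (row i alpha)^T).

(* Apply a vector program to every column, resp. row, of a matrix. *)
Definition on_cols (T : Type) (H W : nat)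
    (f : 'I_W -> 'cV[T]_H -> prog T 'cV[T]_H) (X : 'M[T]_(H, W)) :
    prog T 'M[T]_(H, W) :=
  let* F := For (fun l => f l (col l X)) in
  Ret (\matrix_(i, l) F l i ord0).

Definition on_rows (T : Type) (H W : nat)
    (f : 'I_H -> 'cV[T]_W -> prog T 'cV[T]_W) (Z : 'M[T]_(H, W)) :
    prog T 'M[T]_(H, W) :=
  let* F := For (fun i => f i (row i Z)^T) in
  Ret (\matrix_(i, j) F i j ord0).

Definition Z_prog (T : Type) (H W : nat) (B : {ffun 'I_W -> 'M[T]_H})
    (X : 'M[T]_(H, W)) : prog T 'M[T]_(H, W) :=
  on_cols (fun l => matvec (B l)) X.

Definition Y_prog (T : Type) (H W : nat) (A : {ffun 'I_H -> 'M[T]_W})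
    (Z : 'M[T]_(H, W)) : prog T 'M[T]_(H, W) :=
  on_rows (fun i => matvec (A i)) Z.

Definition polyline_mul (T : Type) (H W : nat) (alpha beta : 'M[T]_(H, W))
    (x : 'cV[T]_(H * W)) : prog T 'cV[T]_(H * W) :=
  let* X := unvec_prog x in
  let* B := B_prog beta in
  let* Z := Z_prog B X in
  let* A := A_prog alpha in
  let* Y := Y_prog A Z in
  vec_prog Y.

(* The baseline: store all entries of L, then multiply the dense matrix by x. *)
Definition direct_mul (T : Type) (H W : nat) (alpha beta : 'M[T]_(H, W))
    (x : 'cV[T]_(H * W)) : prog T 'cV[T]_(H * W) :=
  let* A := A_prog alpha in
  let* B := B_prog beta in
  let* L := For2 (fun p q : 'I_(H * W) =>
    Do (Mul (A (grid_row p) (grid_col p) (grid_col q))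
            (B (grid_col q) (grid_row p) (grid_row q)))) in
  matvec L x.

Definition nchunks (q n : nat) : nat := ((n + q) %/ q.+1)%N.

Lemma nchunks_subproof (q n : nat) : (n <= nchunks q n * q.+1)%N.
Proof.
rewrite -(leq_add2r q) {1}(divn_eq (n + q) q.+1) leq_add2l -ltnS.
exact: ltn_pmod.
Qed.

(* Cut v into chunks of length q+1, the last one padded with zeros. *)
Definition chunk_prog (T : Type) (q n : nat) (v : 'cV[T]_n) :
    prog T 'M[T]_(nchunks q n, q.+1) :=
  For2 (fun c r =>
    Do (if (insub (c * q.+1 + r)%N : option 'I_n) is Some k
        then Copy (v k ord0) else Zero)).

(* The chunkwise (state space dual) algorithm of Mamba2 with chunk size q+1, for
   the scalar 1-semiseparable matrix generated by a: dense products with the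
   diagonal blocks (Yd), final state of each chunk started from 0 (s), linear
   recurrence between chunks (h; the state entering chunk c is item c of z :: h),
   and contribution of the entering state to the outputs of its chunk.
   P c r is the product of the generators 0..r of chunk c. *)
Definition chunkwise (T : Type) (q n : nat) (a v : 'cV[T]_n) :
    prog T 'cV[T]_n :=
  let* a' := chunk_prog q a in
  let* v' := chunk_prog q v in
  let* D := For (fun c => semisep1_prog (row c a')^T) in
  let* Yd := For (fun c => matvec (D c) (row c v')^T) in
  let* s := For (fun c => dot (fun r => D c ord_max r) (fun r => v' c r)) in
  let* P := For2 (fun c r => Do (Mul (a' c ord0) (D c r ord0))) in
  let* z := Do Zero in
  let* h := scanM (fun h c => let* t := Do (Mul (P c ord_max) h) in
                              Do (Add t (s c)))
                  z (enum 'I_(nchunks q n)) in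
  let* Y := For2 (fun c r => let* t := Do (Mul (P c r) (nth z (z :: h) c)) in
                             Do (Add (Yd c r ord0) t)) in
  let* F := For (fun i : 'I_n =>
    Do (Copy (vec Y (widen_ord (nchunks_subproof q n) i) ord0))) in
  Ret (\col_i F i).

(* Product with the symmetric matrix M of the segment products of a, as
   T v + T^t v - v with T the 1-semiseparable lower triangular part of M.  In
   reversed order T^t is again 1-semiseparable, with generator a_{n-m} in
   position m > 0 (the generator in position 0 is never used). *)
Definition sym_chunkwise (T : Type) (q n : nat) (a v : 'cV[T]_n) :
    prog T 'cV[T]_n :=
  let* t := chunkwise q a v in
  let* u := chunkwise q (\col_m a (ordS (rev_ord m)) ord0)
                        (\col_m v (rev_ord m) ord0) in
  let* F := For (fun i =>
    let* w := Do (Add (t i ord0) (u (rev_ord i) ord0)) in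
    Do (Sub w (v i ord0))) in
  Ret (\col_i F i).

(* polyline_mul with the products by B^l and A^i done chunkwise, directly from
   their generators: these matrices, which have HW(H+W) entries in all, are no
   longer stored. *)
Definition polyline_mul_chunkwise (T : Type) (q H W : nat)
    (alpha beta : 'M[T]_(H, W)) (x : 'cV[T]_(H * W)) :
    prog T 'cV[T]_(H * W) :=
  let* X := unvec_prog x in
  let* Z := on_cols (fun l => sym_chunkwise q (col l beta)) X in
  let* Y := on_rows (fun i => sym_chunkwise q (row i alpha)^T) Z in
  vec_prog Y.

(* Main.v *)
(* The mask factorises over the grid: (L x)_{ij} = sum_l alpha_{i,j:l} sum_k
   beta_{i:k,l} X_{kl}, so L x is obtained by multiplying each column of X by B^l
   and then each row of the result by A^i.
   The product of a 1-semiseparable matrix with v is the trajectory of the scalar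
   recurrence h := a_t h + v_t started from 0.  Cutting the recurrence at the
   chunk boundaries splits each entry into the part started from 0 inside the
   chunk and the entering state times the product of the generators, which is
   what the chunkwise algorithm adds up. *)
Require Import Defs.
From mathcomp Require Import all_boot all_order all_algebra zify ring.
From mathcomp Require Import reals exp.

Set Implicit Arguments.
Unset Strict Implicit.
Unset Printing Implicit Defensive.

Import Order.TTheory GRing.Theory Num.Theory.
Local Open Scope ring_scope.

Section Algorithms.
Context {R : comNzRingType}.

(** * Values and costs of loops, folds, scans and dense products *)

Lemma cost_Bind_Ret A B (p : prog R A) (g : A -> B) :
  cost (Bind p (fun x => Ret (g x))) = cost p.
Proof. exact: addn0. Qed.

Lemma run_For2 m n (f : 'I_m -> 'I_n -> prog R R) :
  run (For2 f) = \matrix_(i, j) run (f i j).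
Proof. by apply/matrixP => i j; rewrite /For2 /= !mxE !ffunE. Qed.

Lemma cost_For A n (f : 'I_n -> prog R A) (c : nat) :
  (forall i, cost (f i) = c) -> cost (For f) = (n * c)%N.
Proof.
by move=> cf; rewrite /= (eq_bigr _ (fun i _ => cf i)) sum_nat_const card_ord.
Qed.

Lemma cost_For2 m n (f : 'I_m -> 'I_n -> prog R R) (c : nat) :
  (forall i j, cost (f i j) = c) -> cost (For2 f) = (m * n * c)%N.
Proof.
move=> cf; rewrite /For2 cost_Bind_Ret -mulnA.
by apply: cost_For => i; apply: cost_For.
Qed.

Lemma cost_For_le A n (f : 'I_n -> prog R A) (c : nat) :
  (forall i, cost (f i) <= c)%N -> (cost (For f) <= n * c)%N.
Proof.
move=> cf; rewrite /= -[n in (n * c)%N]card_ord -sum_nat_const.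
by apply: leq_sum.
Qed.

(* Programs are made opaque once their equations are known: [simpl] on [run] and
   [cost] would otherwise unfold them down to the instructions. *)
#[local] Opaque For2.

Lemma run_foldM A U (f : A -> U -> prog R A) a s :
  run (foldM f a s) = foldl (fun a u => run (f a u)) a s.
Proof. by elim: s a => //= u s IHs a; rewrite IHs. Qed.

Lemma cost_foldM A U (f : A -> U -> prog R A) a s (c : nat) :
  (forall a u, cost (f a u) = c) -> cost (foldM f a s) = (size s * c)%N.
Proof. by move=> cf; elim: s a => //= u s IHs a; rewrite IHs cf mulSn. Qed.

Lemma run_scanM A U (f : A -> U -> prog R A) a s :
  run (scanM f a s) = scanl (fun a u => run (f a u)) a s.
Proof. by elim: s a => //= u s IHs a; rewrite IHs. Qed.

Lemma cost_scanM A U (f : A -> U -> prog R A) a s (c : nat) :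
  (forall a u, cost (f a u) = c) -> cost (scanM f a s) = (size s * c)%N.
Proof. by move=> cf; elim: s a => //= u s IHs a; rewrite IHs cf addn0 mulSn. Qed.


Lemma foldl_sum U (f : U -> R) x s :
  foldl (fun acc u => acc + f u) x s = x + \sum_(u <- s) f u.
Proof.
by elim: s x => [|u s IHs] x /=; rewrite ?big_nil ?addr0 // big_cons IHs addrA.
Qed.

Lemma foldl_prod U (f : U -> R) x s :
  foldl (fun acc u => acc * f u) x s = x * \prod_(u <- s) f u.
Proof.
by elim: s x => [|u s IHs] x /=; rewrite ?big_nil ?mulr1 // big_cons IHs mulrA.
Qed.

Lemma run_dot n (u v : 'I_n -> R) : run (dot u v) = \sum_i u i * v i.
Proof. by rewrite /dot /= run_foldM /= foldl_sum add0r big_enum. Qed.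

Lemma cost_dot n (u v : 'I_n -> R) : cost (dot u v) = (n * 2).+1.
Proof. by rewrite /dot /= (cost_foldM _ _ (c := 2)) // size_enum_ord. Qed.

#[local] Opaque dot.

Lemma run_matvec m n (M : 'M[R]_(m, n)) v : run (matvec M v) = M *m v.
Proof.
by apply/matrixP => i k; rewrite /matvec /= !mxE ffunE run_dot (ord1 k).
Qed.

Lemma cost_matvec m n (M : 'M[R]_(m, n)) v :
  cost (matvec M v) = (m * (n * 2).+1)%N.
Proof.
by rewrite /matvec cost_Bind_Ret; apply: cost_For => i; apply: cost_dot.
Qed.

#[local] Opaque matvec.

Lemma run_unvec_prog H W (x : 'cV[R]_(H * W)) : run (unvec_prog x) = unvec x.
Proof. by rewrite run_For2; apply/matrixP => i j; rewrite mxE. Qed.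

Lemma cost_unvec_prog H W (x : 'cV[R]_(H * W)) :
  cost (unvec_prog x) = (H * W)%N.
Proof. by rewrite (cost_For2 (c := 1)) ?muln1. Qed.

Lemma run_vec_prog H W (X : 'M[R]_(H, W)) : run (vec_prog X) = vec X.
Proof. by apply/matrixP => p k; rewrite /vec_prog /= !mxE ffunE mxE. Qed.

Lemma cost_vec_prog H W (X : 'M[R]_(H, W)) : cost (vec_prog X) = (H * W)%N.
Proof. by rewrite /vec_prog /= addn0 sum_nat_const card_ord muln1. Qed.

Lemma col_run_on_cols H W (f : 'I_W -> 'cV[R]_H -> prog R 'cV[R]_H) X l :
  col l (run (on_cols f X)) = run (f l (col l X)).
Proof. by apply/matrixP => i k; rewrite !mxE ffunE (ord1 k). Qed.

Lemma row_run_on_rows H W (f : 'I_H -> 'cV[R]_W -> prog R 'cV[R]_W) Z i :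
  (row i (run (on_rows f Z)))^T = run (f i (row i Z)^T).
Proof. by apply/matrixP => j k; rewrite !mxE ffunE (ord1 k). Qed.

Lemma cost_on_cols_le H W (f : 'I_W -> 'cV[R]_H -> prog R 'cV[R]_H) X c :
  (forall l v, cost (f l v) <= c)%N -> (cost (on_cols f X) <= W * c)%N.
Proof. by move=> cf; rewrite /on_cols cost_Bind_Ret; apply: cost_For_le. Qed.

Lemma cost_on_rows_le H W (f : 'I_H -> 'cV[R]_W -> prog R 'cV[R]_W) Z c :
  (forall i v, cost (f i v) <= c)%N -> (cost (on_rows f Z) <= H * c)%N.
Proof. by move=> cf; rewrite /on_rows cost_Bind_Ret; apply: cost_For_le. Qed.

(** * Tables of segment products and the matrices read off from them *)

Lemma cost_segments_le n (a : 'cV[R]_n) : (cost (segments a) <= n * n)%N.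
Proof.
(* Each segment product extends the previous one by a single factor, so row [j] takes [n - j]
   instructions, the initial [One] included. *)
apply: cost_For_le => j /=; rewrite (cost_scanM _ _ (c := 1)) //.
by rewrite muln1 size_drop size_enum_ord; have := ltn_ord j; lia.
Qed.

Lemma run_segments n (a : 'cV[R]_n) j :
  run (segments a) j
  = 1 :: scanl (fun acc t => acc * a t ord0) 1 (drop j.+1 (enum 'I_n)).
Proof. by rewrite /segments /= ffunE /= run_scanM. Qed.

#[local] Opaque segments.

Lemma cost_decay_prog_le n (a : 'cV[R]_n) :
  (cost (decay_prog a) <= (n * n * 2).+1)%N.
Proof.
rewrite /decay_prog /= (cost_For2 (c := 1)) //.
have := cost_segments_le a; lia.
Qed.

Lemma cost_semisep1_prog_le n (a : 'cV[R]_n) :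
  (cost (semisep1_prog a) <= (n * n * 2).+1)%N.
Proof.
rewrite /semisep1_prog /= (cost_For2 (c := 1)) => [|i j].
  have := cost_segments_le a; lia.
by case: ifP.
Qed.

(** Products over intervals of [nat] can be split and shifted freely, unlike filtered products over
    ordinals. [A] may be any extension of [u]. *)
Lemma prod_ord_nat n (u : 'I_n -> R) (A : nat -> R) j i :
  (forall t : 'I_n, A t = u t) -> (i < n)%N ->
  \prod_(t < n | (j < t <= i)%N) u t = \prod_(j.+1 <= t < i.+1) A t.
Proof.
move=> Au lt_in; rewrite (big_nat_widen _ _ n) // big_geq_mkord.
by apply: eq_big => [t|t _]; [rewrite ltnS andbC | rewrite Au].
Qed.

Lemma segprod_nat n (u : 'I_n -> R) (A : nat -> R) i k :
  (forall t : 'I_n, A t = u t) ->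
  segprod u i k = if (k <= i)%N then \prod_(k.+1 <= t < i.+1) A t
                  else \prod_(i.+1 <= t < k.+1) A t.
Proof.
move=> Au; rewrite /segprod !(prod_ord_nat _ Au) //.
by case: ltngtP => // ->; rewrite big_geq.
Qed.

Lemma semisep1E n (a : 'cV[R]_n) (A : nat -> R) i j :
  (forall t : 'I_n, A t = a t ord0) ->
  semisep1 a i j = if (j <= i)%N then \prod_(j.+1 <= t < i.+1) A t else 0.
Proof.
move=> Aa; rewrite mxE (prod_ord_nat _ Aa) //.
case: ltngtP => [|lt_ij|eq_ij] //.
  by rewrite -val_eqE /= ltn_eqF.
by rewrite -val_eqE /= eq_ij eqxx big_geq.
Qed.

Lemma nth_segments n (a : 'cV[R]_n) (A : nat -> R) (j : 'I_n) d o :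
  (forall t : 'I_n, A t = a t ord0) -> (j + d < n)%N ->
  nth o (run (segments a) j) d = \prod_(j.+1 <= t < (j + d).+1) A t.
Proof.
(* Position [d] lies inside the list, so the default value of [nth] is irrelevant. *)
move=> Aa lt_jd; rewrite run_segments (set_nth_default 1) /=; last first.
  by rewrite size_scanl size_drop size_enum_ord; lia.
rewrite nth_cons_scanl; last by rewrite size_drop size_enum_ord; lia.
rewrite foldl_prod mul1r; under eq_bigr => t _ do rewrite -Aa.
rewrite -(big_map val xpredT A) map_take map_drop val_enum_ord.
rewrite drop_iota take_iota /index_iota add0n; congr bigop; congr iota; lia.
Qed.

(** The value 0 past the end matches the padding of [chunk_prog]: a chunk is then a shifted window
    of [extend]. *)
Definition extend n (a : 'cV[R]_n) (k : nat) : R :=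
  if insub k is Some i then a i ord0 else 0.

Lemma extendE n (a : 'cV[R]_n) (i : 'I_n) : extend a i = a i ord0.
Proof. by rewrite /extend valK. Qed.

Lemma run_decay_prog n (a : 'cV[R]_n) :
  run (decay_prog a) = \matrix_(i, k) segprod (fun t => a t ord0) i k.
Proof.
rewrite /decay_prog /= run_For2; apply/matrixP => i k.
rewrite !mxE (segprod_nat _ _ (extendE a)) /=.
by case: leqP => [le_ki | /ltnW le_ik];
  rewrite (nth_segments _ (extendE a)) subnKC.
Qed.

Lemma run_semisep1_prog n (a : 'cV[R]_n) : run (semisep1_prog a) = semisep1 a.
Proof.
rewrite /semisep1_prog /= run_For2; apply/matrixP => i k.
rewrite [LHS]mxE (semisep1E _ _ (extendE a)) /=.
case: leqP => [le_ki | //].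
by rewrite /= (nth_segments _ (extendE a)) subnKC.
Qed.

#[local] Opaque decay_prog semisep1_prog.

(** * Scalar affine recurrences as products with 1-semiseparable matrices *)

Fixpoint affine_rec (A V : nat -> R) (h : R) (k : nat) : R :=
  if k is k'.+1 then A k' * affine_rec A V h k' + V k' else h.

(** Input [V r] is multiplied by all later coefficients, and the initial state by all of them. *)
Lemma affine_rec_closed A V h k :
  affine_rec A V h k = (\prod_(0 <= t < k) A t) * h
                       + \sum_(0 <= r < k) (\prod_(r.+1 <= t < k) A t) * V r.
Proof.
elim: k => [|k IHk] /=; first by rewrite !big_geq // mul1r addr0.
rewrite IHk !(@big_nat_recr _ _ _ _ 0%N) //= (@big_geq _ _ _ k.+1) //.
rewrite mul1r mulrDr.
rewrite mulrA [A k * _]mulrC addrA; congr (_ + _ + _).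
rewrite mulr_sumr; apply: eq_big_nat => r /andP[_ lt_rk].
by rewrite [in RHS]big_nat_recr //= mulrA [A k * _]mulrC.
Qed.

Lemma affine_recD A V h m k :
  affine_rec A V h (m + k)
  = affine_rec (fun t => A (m + t)%N) (fun t => V (m + t)%N)
               (affine_rec A V h m) k.
Proof. by elim: k => [|k IHk]; rewrite ?addn0 // addnS /= IHk. Qed.

(** Linearity separates the evolution of the initial state from the response to [V] started at 0. *)
Lemma affine_rec_start A V h k :
  affine_rec A V h k = (\prod_(0 <= t < k) A t) * h + affine_rec A V 0 k.
Proof. by rewrite !affine_rec_closed mulr0 add0r. Qed.

(** Row [i] holds the weights of the closed form at time [i.+1], once inputs 0 to [i] are absorbed;
    the zeros above the diagonal cut the sum off there. *)
Lemma semisep1_mul n (a v : 'cV[R]_n) (A V : nat -> R) i k :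
  (forall t : 'I_n, A t = a t ord0) -> (forall t : 'I_n, V t = v t ord0) ->
  (semisep1 a *m v) i k = affine_rec A V 0 i.+1.
Proof.
move=> Aa Vv; rewrite mxE affine_rec_closed mulr0 add0r (ord1 k).
rewrite (big_nat_widen _ _ n) //= big_mkord [RHS]big_mkcond /=.
apply: eq_bigr => j _; rewrite (semisep1E _ _ Aa) Vv ltnS.
by case: ifP => // _; rewrite mul0r.
Qed.


(** * Correctness of the chunkwise algorithm *)

Lemma run_chunk_prog q n (v : 'cV[R]_n) :
  run (chunk_prog q v) = \matrix_(c, r) extend v (c * q.+1 + r).
Proof.
rewrite run_For2; apply/matrixP => c r; rewrite !mxE /extend.
by case: insub.
Qed.

Lemma cost_chunk_prog q n (v : 'cV[R]_n) :
  cost (chunk_prog q v) = (nchunks q n * q.+1)%N.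
Proof.
by rewrite (cost_For2 (c := 1)) ?muln1 // => c r; case: insub.
Qed.

#[local] Opaque chunk_prog.

Lemma run_chunkwise q n (a v : 'cV[R]_n) :
  run (chunkwise q a v) = semisep1 a *m v.
Proof.
pose A := extend a; pose V := extend v.
rewrite /chunkwise /= !run_chunk_prog !run_For2.
set a' := \matrix_(_, _) extend a _; set v' := \matrix_(_, _) extend v _.
set D := [ffun c => run (semisep1_prog _)].
set Yd := [ffun c => run (matvec _ _)].
set s := [ffun c => run (dot _ _)].
set P := \matrix_(_, _) run (Do (Mul (a' _ _) _)).
apply/matrixP => i k; rewrite mxE ffunE mxE mxE /= run_scanM /=.
pose f h c := P c ord_max * h + s c; rewrite -/f.
rewrite (semisep1_mul (A := A) (V := V)) //; try exact: extendE.
(* Coefficients and inputs as seen from the start of chunk [c]. *)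
pose Ac (c t : nat) := A (c * q.+1 + t)%N.
pose Vc (c t : nat) := V (c * q.+1 + t)%N.
have DE c : D c = semisep1 (row c a')^T by rewrite ffunE run_semisep1_prog.
have YdE c r : Yd c r ord0 = affine_rec (Ac c) (Vc c) 0 r.+1.
  rewrite ffunE run_matvec DE.
  by rewrite (semisep1_mul (A := Ac c) (V := Vc c)) // => t; rewrite !mxE.
(* The last row of a diagonal block yields the final state of the chunk. *)
have sE c : s c = affine_rec (Ac c) (Vc c) 0 q.+1.
  rewrite ffunE run_dot DE.
  rewrite -(semisep1_mul ord_max ord0 (a := (row c a')^T) (v := (row c v')^T));
    try by move=> t; rewrite !mxE.
  by rewrite mxE; apply: eq_bigr => r _; rewrite !mxE.
(* Column 0 of [D c] only multiplies generators 1 to [r]; the factor [a' c ord0] supplies generator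
   0, which also acts on the entering state. *)
have PE c r : P c r = \prod_(0 <= t < r.+1) Ac c t.
  rewrite mxE /= DE (semisep1E (A := Ac c)) => [|t]; last by rewrite !mxE.
  by rewrite leq0n mxE [RHS]big_ltn.
(* Restart the recurrence at the chunk boundary, then split off the entering state. *)
have step c k' : affine_rec A V 0 (c * q.+1 + k')
    = \prod_(0 <= t < k') Ac c t * affine_rec A V 0 (c * q.+1)
      + affine_rec (Ac c) (Vc c) 0 k'.
  by rewrite affine_recD affine_rec_start.
(* The recurrence between chunks produces the true state at every boundary, by induction on the
   number of chunks passed. *)
have fE c : (c <= nchunks q n)%N ->
    foldl f 0 (take c (enum 'I_(nchunks q n))) = affine_rec A V 0 (c * q.+1).
  elim: c => [|c IHc] lt_c; first by rewrite take0 mul0n.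
  rewrite (take_nth (Ordinal lt_c)) ?size_enum_ord // foldl_rcons.
  rewrite IHc ?(ltnW lt_c) //.
  by rewrite (nth_ord_enum _ (Ordinal lt_c)) /f PE sE mulSnr step.
set c := grid_row _; set r := grid_col _.
have -> : (i %/ q.+1)%N = c by [].
(* Item [c] of [z :: h] is the fold over the first [c] chunks; what remains is [step] at [r.+1],
   since [i] is [c * q.+1 + r]. *)
rewrite nth_cons_scanl ?size_enum_ord ?fE ?(ltnW (ltn_ord c)) // YdE PE.
by rewrite addrC -step addnS -divn_eq.
Qed.

(** * Symmetric decay matrices by reversal *)

Lemma semisep1_rev n (a : 'cV[R]_n) i j :
  semisep1 (\col_m a (ordS (rev_ord m)) ord0) (rev_ord i) (rev_ord j)
  = semisep1 a j i.
Proof.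
rewrite !mxE (inj_eq rev_ord_inj) (eq_sym j).
have -> : (rev_ord j < rev_ord i)%N = (i < j)%N.
  by have := ltn_ord i; have := ltn_ord j; rewrite /=; lia.
(* The substitution of [n - t] modulo [n] for [t] exchanges the two ranges; it fixes 0, which lies
   in neither. *)
case: ifP => // _; rewrite [RHS](reindex_inj (can_inj (@ordSK n))) /=.
rewrite [RHS](reindex_inj rev_ord_inj) /=.
apply: eq_big => t; last by rewrite mxE.
have := ltn_ord t; have := ltn_ord j; have := ltn_ord i => ? ? ?.
case: (posnP t) => [-> | t_gt0]; first by rewrite subn1 prednK ?modnn //; lia.
by rewrite modn_small; lia.
Qed.

(** Common form of [Amx] and [Bmx], so that rows and columns share one argument. *)
Definition decay_mx n (a : 'cV[R]_n) : 'M[R]_n :=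
  \matrix_(i, k) segprod (a^~ ord0) i k.

(** Both triangular parts carry the unit diagonal, which is therefore subtracted once. *)
Lemma decay_mx_semisep1 n (a : 'cV[R]_n) :
  decay_mx a = semisep1 a + (semisep1 a)^T - 1%:M.
Proof.
apply/matrixP => i k; rewrite !mxE /segprod -!val_eqE /=.
case: (ltngtP i k) => _; rewrite ?subr0 ?addr0 ?add0r //.
by rewrite addrK.
Qed.

#[local] Opaque chunkwise.

Lemma run_sym_chunkwise q n (a v : 'cV[R]_n) :
  run (sym_chunkwise q a v) = decay_mx a *m v.
Proof.
rewrite /sym_chunkwise /= !run_chunkwise.
rewrite decay_mx_semisep1 mulmxBl mulmxDl mul1mx.
apply/matrixP => i k; rewrite mxE ffunE /= [RHS]mxE [in RHS]mxE (ord1 k).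
congr (_ + _ + _); last by rewrite mxE.
(* The change of index undoes the reversal of [v] and turns the reversed matrix into the
   transpose. *)
rewrite !mxE (reindex_inj rev_ord_inj); apply: eq_bigr => j _.
by rewrite semisep1_rev !mxE rev_ordK.
Qed.

(** * Factorisation of the mask and values of the multiplication programs *)

Lemma eq_segprod n (u w : 'I_n -> R) i k :
  u =1 w -> segprod u i k = segprod w i k.
Proof. by move=> uw; rewrite /segprod !(eq_bigr _ (fun t _ => uw t)). Qed.

Lemma AmxE H W (alpha : 'M[R]_(H, W)) i :
  Amx alpha i = decay_mx (row i alpha)^T.
Proof.
by apply/matrixP => j l; rewrite !mxE; apply: eq_segprod => t; rewrite !mxE.
Qed.

Lemma BmxE H W (beta : 'M[R]_(H, W)) l : Bmx beta l = decay_mx (col l beta).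
Proof.
by apply/matrixP => i k; rewrite !mxE; apply: eq_segprod => t; rewrite mxE.
Qed.

Lemma run_A_prog H W (alpha : 'M[R]_(H, W)) i :
  run (A_prog alpha) i = Amx alpha i.
Proof. by rewrite /A_prog /= ffunE run_decay_prog AmxE. Qed.

Lemma run_B_prog H W (beta : 'M[R]_(H, W)) l :
  run (B_prog beta) l = Bmx beta l.
Proof. by rewrite /B_prog /= ffunE run_decay_prog BmxE. Qed.

Lemma big_grid H W (F : 'I_(H * W) -> R) :
  \sum_p F p = \sum_i \sum_j F (grid_idx i j).
Proof.
rewrite pair_big /= (reindex (fun ij : 'I_H * 'I_W => grid_idx ij.1 ij.2)) //=.
apply: onW_bij; exists (fun p => (grid_row p, grid_col p)) => [[i j]|p] /=.
  by rewrite grid_rowK grid_colK.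
by rewrite grid_idxK.
Qed.

(** Among the source indices, the [alpha] factor depends on the column only, so the sum over source
    rows can be done first. Describing [Z] and [Y] by their lines serves the dense and the chunkwise
    versions alike. *)
Lemma polyline_mask_mul H W (alpha beta : 'M[R]_(H, W)) x (Z Y : 'M[R]_(H, W)) :
  (forall l, col l Z = Bmx beta l *m col l (unvec x)) ->
  (forall i, (row i Y)^T = Amx alpha i *m (row i Z)^T) ->
  vec Y = polyline_mask alpha beta *m x.
Proof.
move=> colZ rowY; apply/matrixP => p k.
rewrite !mxE (ord1 k) big_grid exchange_big /=.
have := congr1 (fun u : 'cV_W => u (grid_col p) ord0) (rowY (grid_row p)).
rewrite !mxE => ->; apply: eq_bigr => l _.
have := congr1 (fun u : 'cV_H => u (grid_row p) ord0) (colZ l).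
rewrite !mxE => ->; rewrite mulr_sumr; apply: eq_bigr => i _.
by rewrite !mxE grid_rowK grid_colK mulrA.
Qed.

Lemma col_run_Z_prog H W (beta X : 'M[R]_(H, W)) l :
  col l (run (Z_prog (run (B_prog beta)) X)) = Bmx beta l *m col l X.
Proof. by rewrite col_run_on_cols run_matvec run_B_prog. Qed.

Lemma row_run_Y_prog H W (alpha Z : 'M[R]_(H, W)) i :
  (row i (run (Y_prog (run (A_prog alpha)) Z)))^T
  = Amx alpha i *m (row i Z)^T.
Proof. by rewrite row_run_on_rows run_matvec run_A_prog. Qed.

#[local] Opaque A_prog B_prog Y_prog Z_prog vec_prog unvec_prog.
#[local] Opaque on_rows on_cols sym_chunkwise.

Lemma run_polyline_mul H W (alpha beta : 'M[R]_(H, W)) x :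
  run (polyline_mul alpha beta x) = polyline_mask alpha beta *m x.
Proof.
rewrite /polyline_mul /= run_vec_prog.
apply: polyline_mask_mul => [l|i]; last exact: row_run_Y_prog.
by rewrite col_run_Z_prog run_unvec_prog.
Qed.

Lemma run_direct_mul H W (alpha beta : 'M[R]_(H, W)) x :
  run (direct_mul alpha beta x) = polyline_mask alpha beta *m x.
Proof.
rewrite /direct_mul /= run_matvec run_For2; congr mulmx.
by apply/matrixP => p r; rewrite !mxE /= run_A_prog run_B_prog !mxE.
Qed.

Lemma run_polyline_mul_chunkwise q H W (alpha beta : 'M[R]_(H, W)) x :
  run (polyline_mul_chunkwise q alpha beta x) = polyline_mask alpha beta *m x.
Proof.
rewrite /polyline_mul_chunkwise /= run_vec_prog.
apply: polyline_mask_mul => [l|i]; last first.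
  by rewrite row_run_on_rows run_sym_chunkwise -AmxE.
by rewrite col_run_on_cols run_sym_chunkwise run_unvec_prog BmxE.
Qed.

(** * Cost bounds, added stage by stage and uniform in the intermediate results *)

Lemma cost_Bind_le A B (p : prog R A) (k : A -> prog R B) c1 c2 :
  (cost p <= c1)%N -> (forall x, cost (k x) <= c2)%N ->
  (cost (Bind p k) <= c1 + c2)%N.
Proof. by move=> le1 le2; apply: leq_add. Qed.

Lemma cost_Bind_ge A B (p : prog R A) (k : A -> prog R B) c :
  (forall x, c <= cost (k x))%N -> (c <= cost (Bind p k))%N.
Proof. by move=> le_k; apply: leq_trans (le_k _) (leq_addl _ _). Qed.

#[local] Transparent A_prog B_prog Y_prog Z_prog vec_prog unvec_prog.
#[local] Transparent on_rows on_cols sym_chunkwise chunkwise.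

Lemma cost_A_prog_le H W (alpha : 'M[R]_(H, W)) :
  (cost (A_prog alpha) <= H * (W * W * 2).+1)%N.
Proof. by apply: cost_For_le => i; apply: cost_decay_prog_le. Qed.

Lemma cost_B_prog_le H W (beta : 'M[R]_(H, W)) :
  (cost (B_prog beta) <= W * (H * H * 2).+1)%N.
Proof. by apply: cost_For_le => l; apply: cost_decay_prog_le. Qed.

Lemma cost_Y_prog_le H W A (Z : 'M[R]_(H, W)) :
  (cost (Y_prog A Z) <= H * (W * (W * 2).+1))%N.
Proof. by apply: cost_on_rows_le => i v; rewrite cost_matvec. Qed.

Lemma cost_Z_prog_le H W B (X : 'M[R]_(H, W)) :
  (cost (Z_prog B X) <= W * (H * (H * 2).+1))%N.
Proof. by apply: cost_on_cols_le => l v; rewrite cost_matvec. Qed.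

Lemma cost_polyline_mul_le H W (alpha beta : 'M[R]_(H, W)) x :
  (0 < H)%N -> (0 < W)%N ->
  (cost (polyline_mul alpha beta x) <= 7 * (H * W * (H + W)))%N.
Proof.
move=> H_gt0 W_gt0.
(* The four matrix stages give [4 * (H * W * (H + W))]; the remainder [4 * (H * W) + H + W] is at
   most three times [H * W * (H + W)]. *)
apply: (@leq_trans (H * W + (W * (H * H * 2).+1 + (W * (H * (H * 2).+1)
  + (H * (W * W * 2).+1 + (H * (W * (W * 2).+1) + H * W)))))%N); last by nia.
apply: cost_Bind_le => [|X]; first by rewrite cost_unvec_prog.
apply: cost_Bind_le => [|B]; first exact: cost_B_prog_le.
apply: cost_Bind_le => [|Z]; first exact: cost_Z_prog_le.
apply: cost_Bind_le => [|A]; first exact: cost_A_prog_le.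
apply: cost_Bind_le => [|Y]; first exact: cost_Y_prog_le.
by rewrite cost_vec_prog.
Qed.

Lemma cost_direct_mul_bounds H W (alpha beta : 'M[R]_(H, W)) x :
  (0 < H)%N -> (0 < W)%N ->
  ((H * W) ^ 2 <= cost (direct_mul alpha beta x) <= 10 * (H * W) ^ 2)%N.
Proof.
move=> H_gt0 W_gt0; pose N := (H * W)%N; apply/andP; split.
  (* The final dense product alone takes [N * (N * 2).+1] instructions. *)
  do 3!apply: cost_Bind_ge => ?; rewrite cost_matvec -/N; nia.
(* As [H + W <= 2 * N], building the tables costs at most [6 * N ^ 2]; filling [L] and multiplying
   cost at most [4 * N ^ 2]. *)
apply: (@leq_trans (H * (W * W * 2).+1 + (W * (H * H * 2).+1
  + (N * N * 1 + N * (N * 2).+1)))%N); last first.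
  have le_H : (H <= N)%N by rewrite leq_pmulr.
  have le_W : (W <= N)%N by rewrite leq_pmull.
  rewrite addnA; have -> : (H * (W * W * 2).+1 + W * (H * H * 2).+1)%N
            = ((H + W) * (N * 2).+1)%N by rewrite /N; lia.
  nia.
apply: cost_Bind_le => [|A]; first exact: cost_A_prog_le.
apply: cost_Bind_le => [|B]; first exact: cost_B_prog_le.
apply: cost_Bind_le => [|L]; first by rewrite (cost_For2 (c := 1)).
by rewrite cost_matvec.
Qed.

Lemma nchunks_le q n : (nchunks q n <= n)%N.
Proof. by rewrite -ltnS ltn_divLR // mulSn mulnS; lia. Qed.

Lemma cost_chunkwise_le q n (a v : 'cV[R]_n) :
  (cost (chunkwise q a v) <= n * (4 * q.+1 ^ 2 + 8 * q.+1 + 5) + 1)%N.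
Proof.
pose m := nchunks q n; pose s := q.+1.
(* The sum is [m * (4 * s ^ 2 + 8 * s + 4) + n + 1]. The crude bound [m <= n] loses only a factor
   depending on the fixed chunk size. *)
apply: (@leq_trans (m * s + (m * s + (m * (s * s * 2).+1 + (m * (s * (s * 2).+1)
  + (m * (s * 2).+1 + (m * s * 1 + (1 + (m * 2 + (m * s * 2 + n)))))))))%N); last first.
  by have := nchunks_le q n; rewrite -/m -/s; nia.
apply: cost_Bind_le => [|a']; first by rewrite cost_chunk_prog.
apply: cost_Bind_le => [|v']; first by rewrite cost_chunk_prog.
apply: cost_Bind_le => [|D].
  by apply: cost_For_le => c; apply: cost_semisep1_prog_le.
apply: cost_Bind_le => [|Yd]; first by apply: cost_For_le => c; rewrite cost_matvec.
apply: cost_Bind_le => [|u]; first by apply: cost_For_le => c; rewrite cost_dot.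
apply: cost_Bind_le => [|P]; first by rewrite (cost_For2 (c := 1)).
apply: cost_Bind_le => // z.
apply: cost_Bind_le => [|h].
  by rewrite (cost_scanM _ _ (c := 2)) // size_enum_ord.
apply: cost_Bind_le => [|Y]; first by rewrite (cost_For2 (c := 2)).
by rewrite cost_Bind_Ret (cost_For (c := 1)) ?muln1.
Qed.

Lemma cost_sym_chunkwise_le q n (a v : 'cV[R]_n) :
  (cost (sym_chunkwise q a v) <= n * (8 * q.+1 ^ 2 + 16 * q.+1 + 12) + 2)%N.
Proof.
pose c := (n * (4 * q.+1 ^ 2 + 8 * q.+1 + 5) + 1)%N.
apply: (@leq_trans (c + (c + n * 2))%N); last by rewrite /c; lia.
apply: cost_Bind_le => [|t]; first exact: cost_chunkwise_le.
apply: cost_Bind_le => [|u]; first exact: cost_chunkwise_le.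
by rewrite cost_Bind_Ret (cost_For (c := 2)).
Qed.

Lemma cost_polyline_mul_chunkwise_le q H W (alpha beta : 'M[R]_(H, W)) x :
  (0 < H)%N -> (0 < W)%N ->
  (cost (polyline_mul_chunkwise q alpha beta x)
   <= (16 * q.+1 ^ 2 + 32 * q.+1 + 30) * (H * W))%N.
Proof.
move=> H_gt0 W_gt0; pose K := (8 * q.+1 ^ 2 + 16 * q.+1 + 12)%N.
(* The overhead of 2 per line totals [2 * (H + W) <= 4 * (H * W)]; with the two reshapings this
   gives the 6 in [2 * K + 6]. *)
apply: (@leq_trans (H * W + (W * (H * K + 2) + (H * (W * K + 2) + H * W)))%N);
  last first.
  have le_H : (H <= H * W)%N by rewrite leq_pmulr.
  have le_W : (W <= H * W)%N by rewrite leq_pmull.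
  have -> : (16 * q.+1 ^ 2 + 32 * q.+1 + 30 = 2 * K + 6)%N by rewrite /K; lia.
  move: (K) => k; nia.
apply: cost_Bind_le => [|X]; first by rewrite cost_unvec_prog.
apply: cost_Bind_le => [|Z].
  by apply: cost_on_cols_le => l v; apply: cost_sym_chunkwise_le.
apply: cost_Bind_le => [|Y].
  by apply: cost_on_rows_le => i v; apply: cost_sym_chunkwise_le.
by rewrite cost_vec_prog.
Qed.

End Algorithms.

(** * The exponent 3/2 on grids of bounded aspect ratio *)

Lemma powR_three_halves (R : realType) (x : R) :
  0 <= x -> x `^ (3%:R / 2%:R) = x * Num.sqrt x.
Proof.
move=> x_ge0; have -> : 3%:R / 2%:R = 1 + 2^-1 :> R by field.
(* [powRD] allows base 0 when the exponents do not sum to 0, which is the side condition left. *)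
rewrite powRD ?powRr1 ?powR12_sqrt //; apply/implyP => /eqP/esym h0.
by have : 0 < 1 + 2^-1 :> R; [rewrite addr_gt0 ?invr_gt0 | rewrite -h0 ltxx].
Qed.

(** Compare squares: [H ^ 2] and [W ^ 2] are at most [kappa * (H * W)], so [(H + W) ^ 2] is at most
    [(2 * kappa + 2) * (H * W)]. On a single row, by contrast, [H + W] exceeds the number of
    cells. *)
Lemma addn_le_sqrt_mul (R : realType) (kappa H W : nat) :
  (H <= kappa * W)%N -> (W <= kappa * H)%N ->
  (H + W)%:R <= (2 * kappa.+1)%:R * Num.sqrt (H * W)%:R :> R.
Proof.
move=> leH leW; have le2 : ((H + W) ^ 2 <= (2 * kappa.+1) ^ 2 * (H * W))%N by nia.
rewrite -[leLHS]ger0_norm // -[X in _ <= X * _]ger0_norm // -!sqrtr_sqr.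
by rewrite -sqrtrM ?sqr_ge0 // ler_wsqrtr // -!natrX -natrM ler_nat.
Qed.

Theorem corollary2 (R : realType) :
  (* each step computes the stated matrix, and all three programs compute L x *)
  (forall (H W : nat) (alpha beta : 'M[R]_(H, W)) (x : 'cV[R]_(H * W)),
     (0 < H)%N -> (0 < W)%N -> decay_factors alpha -> decay_factors beta ->
     [/\ run (unvec_prog x) = unvec x,
         forall l, run (B_prog beta) l = Bmx beta l,
         forall (X : 'M[R]_(H, W)) l,
           col l (run (Z_prog (run (B_prog beta)) X)) = Bmx beta l *m col l X,
         forall i, run (A_prog alpha) i = Amx alpha i
       & forall (Z : 'M[R]_(H, W)) i,
           (row i (run (Y_prog (run (A_prog alpha)) Z)))^T
           = Amx alpha i *m (row i Z)^T]
     /\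
     [/\ forall Y : 'M[R]_(H, W), run (vec_prog Y) = vec Y,
         run (direct_mul alpha beta x) = polyline_mask alpha beta *m x,
         run (polyline_mul alpha beta x) = polyline_mask alpha beta *m x
       & forall q : nat,
           run (polyline_mul_chunkwise q alpha beta x)
           = polyline_mask alpha beta *m x])
  /\
  (* the chunkwise program multiplies by 1-semiseparable matrices *)
  (forall (q n : nat) (a v : 'cV[R]_n),
     run (chunkwise q a v) = semisep1 a *m v)
  /\
  (* direct multiplication has cost of order N^2 *)
  (exists C : nat, forall (H W : nat) (alpha beta : 'M[R]_(H, W))
                          (x : 'cV[R]_(H * W)),
     (0 < H)%N -> (0 < W)%N -> decay_factors alpha -> decay_factors beta ->
     ((H * W) ^ 2 <= cost (direct_mul alpha beta x) <= C * (H * W) ^ 2)%N)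
  /\
  (* the algorithm costs O(N (H + W)) on every grid *)
  (exists C : nat, forall (H W : nat) (alpha beta : 'M[R]_(H, W))
                          (x : 'cV[R]_(H * W)),
     (0 < H)%N -> (0 < W)%N -> decay_factors alpha -> decay_factors beta ->
     (cost (polyline_mul alpha beta x) <= C * (H * W * (H + W)))%N)
  /\
  (* hence O(N^(3/2)) on grids of bounded aspect ratio *)
  (forall kappa : nat,
     exists C : R, forall (H W : nat) (alpha beta : 'M[R]_(H, W))
                          (x : 'cV[R]_(H * W)),
     (0 < H)%N -> (0 < W)%N -> (H <= kappa * W)%N -> (W <= kappa * H)%N ->
     decay_factors alpha -> decay_factors beta ->
     (cost (polyline_mul alpha beta x))%:R
       <= C * ((H * W)%N%:R `^ (3%:R / 2%:R)))
  /\
  (* with the chunkwise algorithm, of any fixed chunk size q + 1, O(N) *)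
  (forall q : nat,
     exists C : nat, forall (H W : nat) (alpha beta : 'M[R]_(H, W))
                            (x : 'cV[R]_(H * W)),
     (0 < H)%N -> (0 < W)%N -> decay_factors alpha -> decay_factors beta ->
     (cost (polyline_mul_chunkwise q alpha beta x) <= C * (H * W))%N).

Proof.
split=> [H W alpha beta x _ _ _ _|].
  split; split.
  - exact: run_unvec_prog.
  - exact: run_B_prog.
  - exact: col_run_Z_prog.
  - exact: run_A_prog.
  - exact: row_run_Y_prog.
  - exact: run_vec_prog.
  - exact: run_direct_mul.
  - exact: run_polyline_mul.
  - by move=> q; apply: run_polyline_mul_chunkwise.
split; first by move=> q n a v; apply: run_chunkwise.
split.
  by exists 10%N => H W alpha beta x H_gt0 W_gt0 _ _; apply: cost_direct_mul_bounds.
split.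
  by exists 7%N => H W alpha beta x H_gt0 W_gt0 _ _; apply: cost_polyline_mul_le.
split=> [kappa | q].
  (* The factor 7 comes from [cost_polyline_mul_le], the other from [addn_le_sqrt_mul]. *)
  exists (7 * (2 * kappa.+1))%:R => H W alpha beta x H_gt0 W_gt0 leH leW _ _.
  rewrite powR_three_halves // natrM mulrACA -natrM.
  apply: le_trans (ler_wpM2l _ (addn_le_sqrt_mul _ leH leW)); last by [].
  by rewrite -natrM ler_nat -mulnA; apply: cost_polyline_mul_le.
exists (16 * q.+1 ^ 2 + 32 * q.+1 + 30)%N => H W alpha beta x H_gt0 W_gt0 _ _.
exact: cost_polyline_mul_chunkwise_le.
Qed.
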